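(* Let $f:\mathbb{R}^n\to\mathbb{R}$ be twice continuously differentiable. Suppose there exist $R\in\mathbb{N}$ and polynomials $p_R(\alpha)=\sum_{i=0}^{R}a_i\alpha^i$ and $q_{R+1}(\alpha)=\sum_{i=0}^{R+1}b_i\alpha^i$ of degree $R$ and $R+1$, respectively, with $b_{R+1}>0$, such that $\|\nabla^2 f(x)\|_F\le p_R(\|x\|)$ and $\|\nabla f(x)\|\ge q_{R+1}(\|x\|)$ for all $x\in\mathbb{R}^n$. Let $\phi$ be a reference function on $\mathbb{R}^n$ that satisfies the smoothness condition (S) and the isotropy condition (I) given in the context. Then for any $\bar L>0$ there exists an $L>0$ such that $f$ satisfies the second-order characterization of $(L,\bar L)$-anisotropic smoothness relative to $\phi$, i.e. $$\lambda_{\max}\big(\nabla^2\phi^*(\bar L^{-1}\nabla f(x))\,\nabla^2 f(x)\big)\le L\bar L\qquad\text{for all }x\in\mathbb{R}^n.$$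
   Context: $\|\cdot\|$ is the Euclidean norm on vectors and the spectral norm on matrices; $\|\cdot\|_F$ is the Frobenius norm; $\mathbb{R}_+=[0,\infty)$. Standing assumption: a reference function is a function $\phi:\mathbb{R}^n\to\overline{\mathbb{R}}$ (extended reals) that is proper, lower semicontinuous, strongly convex and even, with $\phi(0)=0$. $\phi^*$ denotes its convex conjugate. Condition (S): $\operatorname{int}\operatorname{dom}\phi\ne\emptyset$; $\phi\in\mathcal{C}^2(\operatorname{int}\operatorname{dom}\phi)$; and for any sequence $(x^k)$ converging to some boundary point of $\operatorname{int}\operatorname{dom}\phi$, $\|\nabla\phi(x^k)\|\to\infty$. (This ensures in particular $\phi^*\in\mathcal{C}^2(\mathbb{R}^n)$.) Condition (I): $\phi$ is isotropic, i.e. $\phi(x)=h(\|x\|)$ for a scalar kernel function $h:\mathbb{R}\to\mathbb{R}_+\cup\{\infty\}$, and, with $h^*$ the convex conjugate of $h$: (i) ${h^*}'(y)/y$ is a decreasing function on $\mathbb{R}_+$; (ii) $\lim_{y\to+\infty}y\,{h^*}''(y)=C_2$ for some $C_2\in\mathbb{R}_+$; (iii) $\lim_{y\to+\infty}{h^*}'(s_d(y))/y=0$ for any polynomial $s_d(\alpha)=\sum_{i=0}^d u_i\alpha^i$ of degree $d$. *)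

(* Defs.v *)
From HB Require Import structures.
From mathcomp Require Import all_boot all_order all_algebra.
From mathcomp Require Import all_classical all_reals all_analysis.

Set Implicit Arguments.
Unset Strict Implicit.
Unset Printing Implicit Defensive.

Import Order.TTheory GRing.Theory Num.Theory.
Import numFieldTopology.Exports numFieldNormedType.Exports.

Local Open Scope classical_set_scope.
Local Open Scope ring_scope.

(* The library norm on matrices is the max norm, so the Euclidean and Frobenius
   norms are defined here; all of them induce the same topology and the same
   notion of differentiability. *)
Definition dotp {R : realType} {n : nat} (x y : 'rV[R]_n) : R :=
  \sum_(i < n) x 0 i * y 0 i.

Definition enorm {R : realType} {n : nat} (x : 'rV[R]_n) : R :=
  Num.sqrt (dotp x x).

Definition fnorm {R : realType} {m n : nat} (A : 'M[R]_(m, n)) : R :=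
  Num.sqrt (\sum_(i < m) \sum_(j < n) A i j ^+ 2).

Definition grad {R : realType} {n : nat} (f : 'rV[R]_n -> R) (x : 'rV[R]_n) :
    'rV[R]_n :=
  \row_(i < n) 'D_(delta_mx 0 i) f x.

(* With the library's row-vector convention for jacobian, the entry (i, j) is the
   i-th partial derivative of the j-th component of the gradient. *)
Definition hess {R : realType} {n : nat} (f : 'rV[R]_n -> R) (x : 'rV[R]_n) :
    'M[R]_n :=
  jacobian (grad f) x.

(* Meant for open U, where continuity at the points of U is continuity on U. *)
Definition C2_on {R : realType} {n : nat} (U : set 'rV[R]_n)
    (f : 'rV[R]_n -> R) : Prop :=
  forall x, U x ->
    [/\ differentiable f x, differentiable (grad f) x &
        {for x, continuous (hess f)}].

(* The largest real eigenvalue. It is used for a product of a positive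
   semidefinite and a symmetric matrix, which is in general not symmetric but
   whose eigenvalues are all real; the set is then finite, and nonempty as soon
   as n > 0, so that the supremum is a maximum. *)
Definition lambda_max {R : realType} {n : nat} (A : 'M[R]_n) : R :=
  sup [set a : R | eigenvalue A a].

Definition dom {R : realType} {T : Type} (phi : T -> \bar R) : set T :=
  [set x | (phi x < +oo)%E].

Definition boundary {T : topologicalType} (A : set T) : set T :=
  closure A `\` interior A.

Definition conjugate {R : realType} {n : nat} (phi : 'rV[R]_n -> \bar R)
    (y : 'rV[R]_n) : \bar R :=
  ereal_sup [set ((dotp x y)%:E - phi x)%E | x in [set: 'rV[R]_n]].

Definition conjugate1 {R : realType} (h : R -> \bar R) (y : R) : \bar R :=
  ereal_sup [set ((t * y)%:E - h t)%E | t in [set: R]].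

Definition proper {R : realType} {T : Type} (phi : T -> \bar R) : Prop :=
  (forall x, (-oo < phi x)%E) /\ (exists x, dom phi x).

Definition strongly_convex {R : realType} {n : nat}
    (phi : 'rV[R]_n -> \bar R) : Prop :=
  exists2 mu : R, 0 < mu &
    forall (x y : 'rV[R]_n) (t : R), 0 < t < 1 ->
      (phi (t *: x + (1 - t) *: y)%R <=
       t%:E * phi x + (1 - t)%:E * phi y
       - (mu / 2 * (t * (1 - t)) * enorm (x - y)%R ^+ 2)%:E)%E.

Definition reference_function {R : realType} {n : nat}
    (phi : 'rV[R]_n -> \bar R) : Prop :=
  [/\ proper phi, lower_semicontinuous phi, strongly_convex phi,
      (forall x, phi (- x) = phi x) & phi 0 = 0%E].

Definition smoothness_condition {R : realType} {n : nat}
    (phi : 'rV[R]_n -> \bar R) : Prop :=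
  let U := interior (dom phi) in
  [/\ U !=set0,
      C2_on U (fine \o phi) &
      forall (x : nat -> 'rV[R]_n) (a : 'rV[R]_n),
        (forall k, U (x k)) -> boundary U a -> x @ \oo --> a ->
        (fun k => enorm (grad (fine \o phi) (x k))) @ \oo --> +oo].

(* Evenness of h is not assumed: phi determines h on [0, +oo[ only, and as
   h 0 = 0 the values at negative reals do not affect h* on [0, +oo[.
   The quotient h*'(y) / y is considered for y > 0 only (at 0 it would be 0 by
   the convention on inverses), and "decreasing" is not strict. *)
Definition isotropy_condition {R : realType} {n : nat}
    (phi : 'rV[R]_n -> \bar R) : Prop :=
  exists h : R -> \bar R,
    let hs := fine \o conjugate1 h in
    [/\ (forall t, (0 <= h t)%E),
        (forall x, phi x = h (enorm x)),
        (forall y z : R, 0 < y -> y <= z -> derive1 hs z / z <= derive1 hs y / y),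
        (exists2 C2 : R, 0 <= C2 & y * derive1n 2 hs y @[y --> +oo] --> C2) &
        (forall s : {poly R}, derive1 hs s.[y] / y @[y --> +oo] --> (0 : R))].

(* Main.v *)
Require Import Defs.
From HB Require Import structures.
From mathcomp Require Import all_boot all_order all_algebra.
From mathcomp Require Import all_classical all_reals all_analysis.
From mathcomp Require Import ring lra polyrcf.

(** The eigenvalues of [H *m hess f x], where [H] is the Hessian of the
    conjugate at [y = Lbar^-1 *: grad f x], are bounded by the operator norm of
    [H] times the Frobenius norm of [hess f x], and the latter is at most
    [p.[r]] with [r = enorm x]. So [H] has to be small where [p.[r]] is large.

    Isotropy reduces [H] to one variable. The conjugate of [phi] is
    [g \o enorm], where [g] is the conjugate of the even function
    [s |-> h `|s|] and agrees with the conjugate of [h] on the half-line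
    (conjugate_radial, conjugate1_even_ext). Strong convexity of [phi] gives
    strong convexity of this even function, and its conjugate then has a
    Lipschitz derivative: this is the two-sided estimate
    [u * d <= g (t + d) - g t <= u * d + K * d ^+ 2]
    (conjugate_quadratic_sandwich). The gradient of the conjugate is thus
    [g'(|y|) y / |y|], whose increments are controlled by those of [g'] and by
    the quotient [g'(|y|) / |y|] (grad_radial_dist). Two bounds on [H] follow:
    a uniform one, [6 * K] (hess_radial_lipschitz), and a pointwise one,
    [|g''(|y|)| + 2 g'(|y|) / |y|] (hess_radial_bound).

    While [r] stays bounded, so does [p.[r]], and the uniform bound suffices.
    When [r] is large, [t = |y|] is at least [w = q.[r] / Lbar], which grows
    like [r ^+ deg q] and dominates [r * p.[r]]. As [t * g''(t)] converges,
    [p.[r] * |g''(t)|] is of the order of [p.[r] / w]; and since [g'(t) / t]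
    decreases in [t],
    [p.[r] * (g'(t) / t) <= (r * p.[r] / w) * (g'(w) / r)], where the first
    factor is bounded and the second tends to [0] because [w] is a polynomial in
    [r] (growth_balance). *)

Set Implicit Arguments.
Unset Strict Implicit.
Unset Printing Implicit Defensive.

Import Order.TTheory GRing.Theory Num.Theory.
Import numFieldTopology.Exports numFieldNormedType.Exports.

Local Open Scope classical_set_scope.
Local Open Scope ring_scope.

(** * Euclidean norm and eigenvalues *)

Lemma dotpC (R : realType) (n : nat) (x y : 'rV[R]_n) : dotp x y = dotp y x.
Proof. by apply: eq_bigr => i _; rewrite mulrC. Qed.

Lemma dotpDl (R : realType) (n : nat) (x y z : 'rV[R]_n) :
  dotp (x + y) z = dotp x z + dotp y z.
Proof. by rewrite -big_split; apply: eq_bigr => i _; rewrite mxE mulrDl. Qed.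

Lemma dotpZl (R : realType) (n : nat) (a : R) (x y : 'rV[R]_n) :
  dotp (a *: x) y = a * dotp x y.
Proof. by rewrite /dotp big_distrr; apply: eq_bigr => i _; rewrite mxE -mulrA. Qed.

Lemma dotpDr (R : realType) (n : nat) (x y z : 'rV[R]_n) :
  dotp z (x + y) = dotp z x + dotp z y.
Proof. by rewrite dotpC dotpDl !(dotpC z). Qed.

Lemma dotpZr (R : realType) (n : nat) (a : R) (x y : 'rV[R]_n) :
  dotp x (a *: y) = a * dotp x y.
Proof. by rewrite dotpC dotpZl dotpC. Qed.

Lemma dotp_ge0 (R : realType) (n : nat) (x : 'rV[R]_n) : 0 <= dotp x x.
Proof. by apply: sumr_ge0 => i _; rewrite -expr2 sqr_ge0. Qed.

Lemma dotp_delta (R : realType) (n : nat) (x : 'rV[R]_n) (i : 'I_n) :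
  dotp x (delta_mx 0 i) = x 0 i.
Proof.
rewrite /dotp (bigD1 i) //= big1 => [|j ji].
  by rewrite mxE !eqxx mulr1 addr0.
by rewrite mxE (negbTE ji) andbF mulr0.
Qed.

Lemma enorm_ge0 (R : realType) (n : nat) (x : 'rV[R]_n) : 0 <= enorm x.
Proof. exact: sqrtr_ge0. Qed.

Lemma sqr_enorm (R : realType) (n : nat) (x : 'rV[R]_n) :
  enorm x ^+ 2 = dotp x x.
Proof. exact: sqr_sqrtr (dotp_ge0 x). Qed.

Lemma enormZ (R : realType) (n : nat) (a : R) (x : 'rV[R]_n) :
  enorm (a *: x) = `|a| * enorm x.
Proof.
by rewrite /enorm dotpZl dotpZr mulrA -expr2 sqrtrM ?sqr_ge0// sqrtr_sqr.
Qed.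

Lemma enorm0 (R : realType) (n : nat) : enorm (0 : 'rV[R]_n) = 0.
Proof. by rewrite -(scale0r 0) enormZ normr0 mul0r. Qed.

Lemma enorm0_eq0 (R : realType) (n : nat) (x : 'rV[R]_n) :
  enorm x = 0 -> x = 0.
Proof.
move=> /(congr1 (fun a => a ^+ 2)); rewrite sqr_enorm expr0n => /eqP.
rewrite psumr_eq0 => [/allP x0|i _]; last by rewrite -expr2 sqr_ge0.
apply/rowP => i; rewrite mxE; apply/eqP; rewrite -sqrf_eq0 expr2.
exact: (x0 i (mem_index_enum i)).
Qed.

Lemma enorm_gt0 (R : realType) (n : nat) (x : 'rV[R]_n) :
  (0 < enorm x) = (x != 0).
Proof.
rewrite lt_def enorm_ge0 andbT; congr negb.
by apply/eqP/eqP => [/enorm0_eq0|->]; last exact: enorm0.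
Qed.

Lemma enorm_delta (R : realType) (n : nat) (i : 'I_n) :
  enorm (delta_mx 0 i : 'rV[R]_n) = 1.
Proof. by rewrite /enorm dotp_delta mxE !eqxx sqrtr1. Qed.

Lemma sqr_enormD (R : realType) (n : nat) (x y : 'rV[R]_n) :
  enorm (x + y) ^+ 2 = enorm x ^+ 2 + dotp x y *+ 2 + enorm y ^+ 2.
Proof. by rewrite !sqr_enorm dotpDl !dotpDr (dotpC y x) mulr2n !addrA. Qed.

(** Expand the square of [enorm y *: x - enorm x *: y]. *)
Lemma cauchy_schwarz (R : realType) (n : nat) (x y : 'rV[R]_n) :
  dotp x y <= enorm x * enorm y.
Proof.
have [-> | x0] := eqVneq x 0.
  by rewrite enorm0 mul0r -(scale0r 0) dotpZl mul0r.
have [-> | y0] := eqVneq y 0.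
  by rewrite enorm0 mulr0 -(scale0r 0) dotpZr mul0r.
have xy0 : 0 < enorm x * enorm y by rewrite mulr_gt0 ?enorm_gt0.
have := sqr_ge0 (enorm (enorm y *: x + (- enorm x) *: y)).
rewrite sqr_enormD !enormZ dotpZl dotpZr normrN !ger0_norm ?enorm_ge0//.
nra.
Qed.

Lemma enormN (R : realType) (n : nat) (x : 'rV[R]_n) : enorm (- x) = enorm x.
Proof. by rewrite -scaleN1r enormZ normrN1 mul1r. Qed.

Lemma normr_cauchy_schwarz (R : realType) (n : nat) (x y : 'rV[R]_n) :
  `|dotp x y| <= enorm x * enorm y.
Proof.
have := cauchy_schwarz (- x) y; rewrite enormN -scaleN1r dotpZl mulN1r => h.
by rewrite ler_norml cauchy_schwarz lerNl h.
Qed.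

Lemma enormD (R : realType) (n : nat) (x y : 'rV[R]_n) :
  enorm (x + y) <= enorm x + enorm y.
Proof.
rewrite -ler_sqr ?nnegrE ?addr_ge0 ?enorm_ge0// sqr_enormD sqrrD.
by rewrite lerD2r lerD2l lerMn2r cauchy_schwarz orbT.
Qed.

Lemma ler_dist_enorm (R : realType) (n : nat) (x y : 'rV[R]_n) :
  `|enorm x - enorm y| <= enorm (x - y).
Proof.
have := enormD (x - y) y; have := enormD (y - x) x; rewrite !subrK.
have -> : enorm (y - x) = enorm (x - y).
  by rewrite -opprB enormN.
by rewrite ler_norml; lra.
Qed.

(** Cauchy-Schwarz against each column of [A]. *)
Lemma enorm_mulmx (R : realType) (n : nat) (v : 'rV[R]_n) (A : 'M[R]_n) :
  enorm (v *m A) <= fnorm A * enorm v.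
Proof.
have A0 : 0 <= \sum_(i < n) \sum_(j < n) A i j ^+ 2.
  by apply: sumr_ge0 => i _; apply: sumr_ge0 => j _; exact: sqr_ge0.
rewrite -ler_sqr ?nnegrE ?mulr_ge0 ?enorm_ge0 ?sqrtr_ge0//.
rewrite exprMn.
have -> : fnorm A ^+ 2 = \sum_(i < n) \sum_(j < n) A i j ^+ 2 := sqr_sqrtr A0.
rewrite (sqr_enorm (v *m A)) exchange_big mulr_suml.
apply: ler_sum => j _ /=; rewrite -expr2 mxE.
pose c := (col j A)^T.
have -> : \sum_k v 0 k * A k j = dotp v c.
  by apply: eq_bigr => k _; rewrite !mxE.
have -> : \sum_i A i j ^+ 2 = enorm c ^+ 2.
  by rewrite sqr_enorm; apply: eq_bigr => k _; rewrite !mxE expr2.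
rewrite -exprMn -[leLHS](real_normK (num_real _)) ler_sqr ?nnegrE ?mulr_ge0 ?enorm_ge0//.
by rewrite mulrC normr_cauchy_schwarz.
Qed.

Lemma enorm_continuous (R : realType) (n : nat) :
  continuous (@enorm R n).
Proof.
move=> x; apply: (@continuous_comp _ _ _ (fun y => dotp y y) Num.sqrt x);
  last exact: sqrt_continuous.
apply: (continuous_big (op := +%R)) => [|i _ z]; first exact: add_continuous.
by apply: (@cvgM _ _ (nbhs z) _ (fun y : 'rV[R]_n => y 0 i)); exact: coord_continuous.
Qed.

Lemma lambda_max_le (R : realType) (n : nat) (A : 'M[R]_n) (c : R) :
  0 <= c -> (forall v : 'rV[R]_n, enorm (v *m A) <= c * enorm v) ->
  lambda_max A <= c.
Proof.
move=> c0 Ac; rewrite /lambda_max.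
have [[a0 Aa0]|/nonemptyPn ->] := pselect ([set a : R | eigenvalue A a] !=set0);
  last by rewrite sup0.
apply: ge_sup; first by exists a0.
move=> a /= /eigenvalueP [v vA v0].
have := Ac v; rewrite vA enormZ ler_pM2r ?enorm_gt0//.
exact: le_trans (ler_norm a).
Qed.

(** * Derivatives from growth estimates *)

(** The differential is chosen among the linear maps that satisfy its defining
    expansion, with the zero map as default. This makes the bounds on Hessians
    below trivial at the points where the gradient is not differentiable. *)
Lemma jacobian_not_differentiable (R : realType) (n : nat)
    (G : 'rV[R]_n -> 'rV[R]_n) (y : 'rV[R]_n) :
  ~ differentiable G y -> jacobian G y = 0.
Proof.
move=> nG; suff E v : @diff _ _ _ _ (Phantom _ (nbhs y)) G v = 0.
  by apply/matrixP => i j; rewrite /jacobian !mxE E mxE.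
move: nG => /diffP; rewrite /diff; case: xgetP => [df E [c h] []|_ _].
  by split.
reflexivity.
Qed.

(** A differentiable map grows along [v] at a rate that tends to the norm of its
    directional derivative, so a local bound on the increments of [G] bounds the
    derivative. *)
Lemma jacobian_bound (R : realType) (n : nat) (G : 'rV[R]_n -> 'rV[R]_n)
    (y v : 'rV[R]_n) (M : R) :
  differentiable G y ->
  (forall e, 0 < e -> \forall s \near (0 : R),
     enorm (G (y + s *: v) - G y) <= `|s| * (M + e)) ->
  enorm (v *m jacobian G y) <= M.
Proof.
move=> dG GM; rewrite -deriveEjacobian//.
have := @diff_derivable _ _ _ G y v dG => cvG.
have {}cvG : (fun h => h^-1 *: ((G \o shift y) (h *: v) - G y)) @ 0^' --> 'D_v G y.
  exact: cvG.
have nG := continuous_cvg _ (@enorm_continuous R n ('D_v G y)) cvG.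
apply/ler_addgt0Pr => e e0.
apply: (closed_cvg _ (@closed_le R (M + e)) _ _ (nG _)); near=> s.
have s0 : s != 0 by near: s; exact: nbhs_dnbhs_neq.
rewrite /= enormZ normfV ler_pdivrMl ?normr_gt0// [s *: v + y]addrC.
by near: s; apply: nbhs_dnbhs; exact: GM.
Unshelve. all: by end_near. Qed.

(** Every derivative computed below comes from a quadratic error estimate along
    the whole line, so no composition rule for [enorm] is needed. *)
Lemma derive_quadratic_bound (R : realType) (V : normedModType R) (f : V -> R)
    (a v : V) (c C : R) :
  (forall s, `|f (a + s *: v) - f a - s * c| <= C * s ^+ 2) ->
  is_derive a v f c.
Proof.
move=> fC; suff cvf : (fun h => h^-1 *: ((f \o shift a) (h *: v) - f a)) @ 0^' --> c.
  by apply: DeriveDef; [apply/cvg_ex; exists c | exact: cvg_lim cvf].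
have C0 : 0 <= C by have := fC 1; rewrite expr1n mulr1; apply: le_trans.
apply/cvgrPdist_le => e e0; near=> s.
have s0 : s != 0 by near: s; exact: nbhs_dnbhs_neq.
have sn : 0 < `|s| by rewrite normr_gt0.
rewrite /= -[_ *: _]/(_ * _) [s *: v + a]addrC.
rewrite -(ler_pM2l sn) -normrM mulrBr mulrA divff// mul1r distrC.
apply: le_trans (fC s) _; rewrite -real_normK ?num_real// expr2 mulrA mulrC.
rewrite ler_pM2l//.
have : `|s| <= e / (C + 1).
  by near: s; apply: dnbhs0_le; rewrite divr_gt0// ltr_wpDl.
rewrite ler_pdivlMr ?ltr_wpDl//; apply: le_trans.
by rewrite mulrC ler_wpM2l// lerDl.
Unshelve. all: by end_near. Qed.

(** * Conjugates of strongly convex functions of one variable *)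

(** Convexity of [g] together with a Lipschitz derivative, stated without
    derivatives: the slope [u] at [t] is then forced to be [derive1 g t]. *)
Definition quadratic_sandwich (R : realType) (K : R) (g : R -> R) : Prop :=
  forall t, exists u, forall d, u * d <= g (t + d) - g t <= u * d + K * d ^+ 2.

(** Here [F] is a finite [mu]-strongly convex function on the convex set [D], and
    [g] is its conjugate, given by the two properties of a supremum. *)
Section smooth_conjugate.
Variables (R : realType) (D : set R) (F : R -> R) (mu : R) (g : R -> R).
Hypothesis mu_gt0 : 0 < mu.
Hypothesis F_convex : forall x y t : R, D x -> D y -> 0 < t < 1 ->
  D (t * x + (1 - t) * y) /\ F (t * x + (1 - t) * y) <=
    t * F x + (1 - t) * F y - mu / 2 * (t * (1 - t)) * (x - y) ^+ 2.
Hypothesis g_ub : forall t x : R, D x -> x * t - F x <= g t.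
Hypothesis g_approx :
  forall t e : R, 0 < e -> exists2 x, D x & g t - e < x * t - F x.

(** Any [u] in [D] that almost attains [g t] serves as a slope. The lower bound
    tests the supremum [g (t + d)] at [u]. For the upper bound, let [x] almost
    attain [g (t + d)]: strong convexity at the midpoint of [x] and [u] shows
    that [x * t - F x] falls short of [g t] by about [mu / 4 * (x - u) ^+ 2], and
    [(x - u) * d - mu / 4 * (x - u) ^+ 2 <= d ^+ 2 / mu]. *)
Lemma conjugate_near_expansion (t e : R) : 0 < e ->
  exists u, forall d,
    u * d - e <= g (t + d) - g t <= u * d + e + mu^-1 * d ^+ 2.
Proof.
move=> e0; have [u Du ue] := g_approx t e0; exists u => d; apply/andP; split.
  by have := g_ub (t + d) Du; lra.
rewrite lerBlDr; apply/ler_addgt0Pl => e' e'0.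
have [x Dx xe] := g_approx (t + d) e'0.
have h : 0 < (2^-1 : R) < 1 by lra.
have [Dm Fm] := F_convex Dx Du h.
have := g_ub t Dm.
have dE : d = mu * (mu^-1 * d) by field; rewrite gt_eqF.
have -> : mu^-1 * d ^+ 2 = mu * (mu^-1 * d) ^+ 2 by field; rewrite gt_eqF.
move: (mu^-1 * d) dE => w dE gm.
have : 0 <= mu * (x - u - 2 * w) ^+ 2 by rewrite mulr_ge0 ?sqr_ge0 ?ltW.
subst d; move: Fm gm.
set m := F (_ + _); move=> Fm gm sq.
lra.
Qed.

(** For each [d != 0] the estimate confines the slope to an interval
    [[lo d, hi d]]. These intervals intersect pairwise, since up to an arbitrarily
    small error they contain a common approximate slope, so the supremum of their
    left ends lies in all of them. This yields an exact slope without a maximizer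
    of [x * t - F x]. *)
Lemma conjugate_quadratic_sandwich : quadratic_sandwich mu^-1 g.
Proof.
move=> t.
pose K := mu^-1; have K0 : 0 < K by rewrite invr_gt0.
pose lo d := if 0 < d then (g (t + d) - g t - K * d ^+ 2) / d
             else (g (t + d) - g t) / d.
pose hi d := if 0 < d then (g (t + d) - g t) / d
             else (g (t + d) - g t - K * d ^+ 2) / d.
have lo_le (e : R) : 0 < e -> exists u, forall d, d != 0 ->
    lo d - e / `|d| <= u <= hi d + e / `|d|.
  move=> e0; have [u ud] := conjugate_near_expansion t e0; exists u => d d0.
  have /andP[] := ud d; rewrite /lo /hi -/K.
  case: ifPn => [dp|]; last first.
    rewrite -leNgt le_eqVlt (negbTE d0)/= => dn.
    rewrite ltr0_norm// invrN mulrN opprK -mulrDl -mulrBl.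
    by rewrite ler_ndivrMr// ler_ndivlMr//; lra.
  rewrite gtr0_norm// -mulrBl -mulrDl ler_pdivrMr// ler_pdivlMr//; lra.
have lohi d d' : d != 0 -> d' != 0 -> lo d <= hi d'.
  move=> d0 d'0; apply/ler_addgt0Pl => e e0.
  pose e1 := e / (`|d|^-1 + `|d'|^-1).
  have s0 : 0 < `|d|^-1 + `|d'|^-1 by rewrite addr_gt0// invr_gt0 normr_gt0.
  have [u ud] := lo_le e1 (divr_gt0 e0 s0).
  have /andP[h1 _] := ud d d0; have /andP[_ h2] := ud d' d'0.
  have <- : e1 * (`|d|^-1 + `|d'|^-1) = e by rewrite divfK ?gt_eqF.
  by lra.
pose u := sup [set lo d | d in [set d | d != 0]].
have lou d : d != 0 -> lo d <= u.
  move=> d0; apply: sup_upper_bound; last by exists d.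
  split; first by exists (lo d), d.
  by exists (hi d) => _ [d' d'0 <-]; exact: lohi.
have uhi d : d != 0 -> u <= hi d.
  move=> d0; apply: ge_sup; first by exists (lo d), d.
  by move=> _ [d' d'0 <-]; exact: lohi.
exists u => d; have [->|d0] := eqVneq d 0.
  by rewrite addr0 subrr !mulr0 expr0n mulr0 addr0 lexx.
have := lou d d0; have := uhi d d0; rewrite /lo /hi -/K.
case: ifPn => [dp|]; last first.
  rewrite -leNgt => dn0; have dn : d < 0 by rewrite lt_neqAle d0.
  by rewrite ler_ndivrMr// ler_ndivlMr//; lra.
by rewrite ler_pdivrMr// ler_pdivlMr//; lra.
Qed.

End smooth_conjugate.

Section derivative_of_sandwich.
Variables (R : realType) (g : R -> R) (K : R).
Hypothesis g_sandwich : quadratic_sandwich K g.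

Lemma derive1_sandwich (t d : R) :
  derive1 g t * d <= g (t + d) - g t <= derive1 g t * d + K * d ^+ 2.
Proof.
have [u ud] := g_sandwich t.
suff -> : derive1 g t = u by exact: ud.
rewrite derive1E.
apply: (@derive_val _ _ _ _ _ _ _ (@derive_quadratic_bound R R g t 1 u K _)) => s.
have /andP[] := ud s; rewrite -[s *: 1]/(s * 1) mulr1 => h1 h2.
by rewrite ger0_norm; lra.
Qed.

Lemma derive1_homo (s t : R) : s <= t -> derive1 g s <= derive1 g t.
Proof.
rewrite le_eqVlt => /predU1P[->//|st].
have /andP[h1 _] := derive1_sandwich s (t - s).
have /andP[h2 _] := derive1_sandwich t (s - t).
have st0 : 0 < t - s by rewrite subr_gt0.
rewrite -(ler_pM2r st0); move: h1 h2; rewrite ![_ + (_ - _)]addrC !subrK; lra.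
Qed.

(** Add the upper estimates at [s] and at [t], each evaluated at the other
    point. *)
Lemma derive1_lip (s t : R) :
  `|derive1 g s - derive1 g t| <= K * 2 * `|s - t|.
Proof.
wlog st : s t / s <= t.
  move=> h; have [/h//|/ltW/h] := leP s t.
  by rewrite distrC [X in _ <= _ * X -> _]distrC.
move: (st); rewrite le_eqVlt => /predU1P[->|st'].
  by rewrite !subrr normr0 mulr0.
have /andP[_ h1] := derive1_sandwich s (t - s).
have /andP[_ h2] := derive1_sandwich t (s - t).
have st0 : 0 < t - s by rewrite subr_gt0.
rewrite !ler0_norm ?subr_le0 ?derive1_homo// !opprB.
rewrite -(ler_pM2r st0); move: h1 h2; rewrite ![_ + (_ - _)]addrC !subrK; nra.
Qed.

End derivative_of_sandwich.

(** [0] is a minimizer of [g]. *)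
Lemma derive1_min (R : realType) (g : R -> R) (K : R) :
  0 <= K ->
  quadratic_sandwich K g ->
  g 0 = 0 -> (forall t, 0 <= g t) -> derive1 g 0 = 0.
Proof.
move=> K0 gK g0 g_ge0.
have h d : 0 <= derive1 g 0 * d + K * d ^+ 2.
  have /andP[_] := derive1_sandwich gK 0 d.
  by rewrite add0r g0 subr0; apply: le_trans.
set c := derive1 g 0 in h *.
(* [- c / (K + 1)] nearly minimizes [c * d + K * d ^+ 2] and avoids dividing by [K],
   which may be [0]. *)
have := h (- c / (K + 1)).
have K1 : K + 1 != 0 by rewrite gt_eqF// ltr_wpDl.
have -> : c * (- c / (K + 1)) + K * (- c / (K + 1)) ^+ 2 = - (c / (K + 1)) ^+ 2.
  by field.
rewrite oppr_ge0 => h2.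
have /eqP : (c / (K + 1)) ^+ 2 = 0 by apply/eqP; rewrite eq_le h2 sqr_ge0.
by rewrite sqrf_eq0 mulf_eq0 invr_eq0 (negbTE K1) orbF => /eqP.
Qed.

(** * Gradient and Hessian of a radial function *)

(** The squares of both sides of [T = enorm (y + s *: v)] give
    [2 * enorm y * (T - enorm y - s * a) = s ^+ 2 * enorm v ^+ 2 - (T - enorm y) ^+ 2],
    where [a = dotp y v / enorm y], and
    [`|T - enorm y| <= `|s| * enorm v]. *)
Lemma enorm_line (R : realType) (n : nat) (y v : 'rV[R]_n) (s : R) : y != 0 ->
  `|enorm (y + s *: v) - enorm y - s * (dotp y v / enorm y)| <=
  enorm v ^+ 2 / enorm y * s ^+ 2.
Proof.
move=> y0; have t0 : 0 < enorm y by rewrite enorm_gt0.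
set T := enorm (y + s *: v); set a := _ / _; set b := _ / _.
have aE : dotp y v = enorm y * a by rewrite mulrC divfK ?gt_eqF.
have bE : enorm v ^+ 2 = enorm y * b by rewrite mulrC divfK ?gt_eqF.
have sqT : T ^+ 2 = enorm y ^+ 2 + s * (enorm y * a) *+ 2 + s ^+ 2 * (enorm y * b).
  by rewrite sqr_enormD enormZ dotpZr exprMn real_normK ?num_real// aE bE.
have dT : (T - enorm y) ^+ 2 <= s ^+ 2 * (enorm y * b).
  rewrite -bE -[leLHS]real_normK ?num_real// -[s ^+ 2]real_normK ?num_real//.
  rewrite -exprMn ler_sqr ?nnegrE ?mulr_ge0 ?enorm_ge0//.
  by apply: le_trans (ler_dist_enorm _ _) _; rewrite addrAC subrr add0r enormZ.
have dT0 := sqr_ge0 (T - enorm y).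
rewrite -(ler_pM2l t0) -{1}(gtr0_norm t0) -normrM ler_norml.
by move: sqT; rewrite mulr2n => sqT; apply/andP; split; lra.
Qed.

Section radial_gradient.
Variables (R : realType) (n : nat) (g : R -> R) (K : R).
Hypothesis K_ge0 : 0 <= K.
Hypothesis g_sandwich : quadratic_sandwich K g.
Hypothesis dg0 : derive1 g 0 = 0.

(** At [y = 0] the right-hand side is [0], as it should be: [g'(0) = 0] makes
    [g (enorm z) - g 0] quadratically small. *)
Lemma grad_radial (y : 'rV[R]_n) :
  grad (g \o enorm) y = (derive1 g (enorm y) / enorm y) *: y.
Proof.
apply/rowP => i; rewrite !mxE.
have [-> | y0] := eqVneq y 0.
  rewrite mxE mulr0; apply: (@derive_val _ _ _ _ _ _ _
    (@derive_quadratic_bound R _ (g \o enorm) 0 _ 0 K _)) => s.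
  rewrite /= add0r enormZ enorm_delta mulr1 enorm0 mulr0 subr0.
  have /andP[] := derive1_sandwich g_sandwich 0 `|s|.
  by rewrite dg0 mul0r !add0r real_normK ?num_real// => h1 h2; rewrite ger0_norm.
set v := delta_mx 0 i; set t := enorm y; pose a := dotp y v / t.
have -> : derive1 g t / t * y 0 i = derive1 g t * a.
  by rewrite /a dotp_delta mulrAC mulrA.
apply: (@derive_val _ _ _ _ _ _ _ (@derive_quadratic_bound R _ (g \o enorm) y v
  (derive1 g t * a) (K + `|derive1 g t| * (enorm v ^+ 2 / t)) _)) => s /=.
have h1 := enorm_line v s y0; rewrite -/t -/a in h1.
have := derive1_sandwich g_sandwich t (enorm (y + s *: v) - t).
rewrite [t + _]addrC subrK => h2.
have h3 := ler_dist_enorm (y + s *: v) y.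
rewrite addrAC subrr add0r enormZ enorm_delta mulr1 -/t in h3.
have h4 : (enorm (y + s *: v) - t) ^+ 2 <= s ^+ 2.
  by rewrite -[leLHS]real_normK ?num_real// -[leRHS]real_normK ?num_real//
     ler_sqr ?nnegrE.
set T := enorm (y + s *: v) in h1 h2 h3 h4 *.
have -> : g T - g t - s * (derive1 g t * a) =
    (g T - g t - derive1 g t * (T - t)) + derive1 g t * (T - t - s * a) by ring.
rewrite mulrDl; apply: le_trans (ler_normD _ _) _; apply: lerD.
  case/andP: h2 => h5 h6; rewrite ger0_norm ?subr_ge0//.
  rewrite lerBlDl; apply: le_trans h6 _; rewrite lerD2l.
  exact: ler_wpM2l.
by rewrite normrM -mulrA ler_wpM2l.
Qed.

(** With [T = enorm z] and [t = enorm y], the difference is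
    [(g'(T) - g'(t)) z / T + g'(t) (z / T - y / t)]; the first direction has norm
    at most [1], and [z / T - y / t] has norm at most [2 * enorm (z - y) / t]. At
    [z = 0] the inverse [T^-1] is [0], which makes the decomposition valid as it
    stands. *)
Lemma grad_radial_dist (y z : 'rV[R]_n) : y != 0 ->
  enorm (grad (g \o enorm) z - grad (g \o enorm) y) <=
  `|derive1 g (enorm z) - derive1 g (enorm y)|
  + 2 * `|derive1 g (enorm y)| / enorm y * enorm (z - y).
Proof.
move=> y0; have t0 : 0 < enorm y by rewrite enorm_gt0.
rewrite !grad_radial; set t := enorm y in t0 *; set T := enorm z.
have -> : (derive1 g T / T) *: z - (derive1 g t / t) *: y =
    ((derive1 g T - derive1 g t) * T^-1) *: z +
    (derive1 g t / t) *: ((z - y) + (t * T^-1 - 1) *: z).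
  apply/rowP => i; rewrite !mxE; move: (T^-1) => iT; field.
  by rewrite gt_eqF.
apply: le_trans (enormD _ _) _.
have zT : `|T^-1| * T <= 1.
  have [->|T0] := eqVneq T 0; first by rewrite mulr0.
  by rewrite normfV ger0_norm ?enorm_ge0// mulVf.
apply: lerD; first by rewrite enormZ normrM -mulrA ler_piMr.
rewrite enormZ normrM normfV (gtr0_norm t0).
have -> : 2 * `|derive1 g t| / t * enorm (z - y) =
  `|derive1 g t| / t * (2 * enorm (z - y)) by ring.
apply: ler_wpM2l; first by rewrite divr_ge0// ltW.
apply: le_trans (enormD _ _) _.
suff : enorm ((t * T^-1 - 1) *: z) <= enorm (z - y) by lra.
have [z0|z0] := eqVneq z 0; first by rewrite z0 scaler0 enorm0 enorm_ge0.
have T0 : 0 < T by rewrite enorm_gt0.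
rewrite enormZ -/T -{2}(gtr0_norm T0) -normrM mulrBl divfK ?gt_eqF// mul1r.
by rewrite distrC ler_dist_enorm.
Qed.

(** [g'] is [2 * K]-Lipschitz and vanishes at [0], so in grad_radial_dist the
    increment of [g'] costs [2 * K] and the quotient [2 * `|g'(t)| / t] costs
    [4 * K]. *)
Lemma hess_radial_lipschitz (y v : 'rV[R]_n) :
  enorm (v *m hess (g \o enorm) y) <= 6 * K * enorm v.
Proof.
have M0 : 0 <= 6 * K * enorm v by rewrite !mulr_ge0 ?enorm_ge0.
rewrite /hess; have [dG|/jacobian_not_differentiable ->] :=
  pselect (differentiable (grad (g \o enorm)) y); last first.
  by rewrite mulmx0 enorm0.
apply: jacobian_bound => // e e0; near=> s.
have lip := derive1_lip g_sandwich.
have dle t : `|derive1 g t| <= K * 2 * `|t|.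
  by have := lip t 0; rewrite dg0 !subr0.
suff h : enorm (grad (g \o enorm) (y + s *: v) - grad (g \o enorm) y) <=
    6 * K * (`|s| * enorm v).
  by apply: le_trans h _; rewrite mulrCA ler_wpM2l// lerDl ltW.
have Ks0 : 0 <= K * (`|s| * enorm v) by rewrite !mulr_ge0 ?enorm_ge0.
have zy : enorm (y + s *: v - y) = `|s| * enorm v.
  by rewrite addrAC subrr add0r enormZ.
have [y0|y0] := eqVneq y 0.
  rewrite !grad_radial y0 add0r scaler0 subr0.
  have -> : enorm (s *: v) = `|s| * enorm v by rewrite enormZ.
  rewrite enormZ enormZ normrM normfV -mulrA.
  rewrite (ger0_norm (mulr_ge0 _ (enorm_ge0 _)))//.
  set w := `|s| * enorm v in Ks0 *.
  have [->|w0] := eqVneq w 0; first by rewrite !mulr0.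
  rewrite divfK//; apply: le_trans (dle w) _.
  by rewrite ger0_norm ?mulr_ge0 ?enorm_ge0//; lra.
apply: le_trans (grad_radial_dist _ y0) _.
have t0 : 0 < enorm y by rewrite enorm_gt0.
have := ler_dist_enorm (y + s *: v) y; rewrite zy => hd.
have h1 : `|derive1 g (enorm (y + s *: v)) - derive1 g (enorm y)| <=
    K * 2 * (`|s| * enorm v).
  by apply: le_trans (lip _ _) _; rewrite ler_wpM2l ?mulr_ge0.
have h2 : 2 * `|derive1 g (enorm y)| / enorm y * (`|s| * enorm v) <=
    4 * K * (`|s| * enorm v).
  apply: ler_wpM2r; first by rewrite mulr_ge0 ?enorm_ge0.
  by rewrite ler_pdivrMr//; have := dle (enorm y); rewrite (gtr0_norm t0); lra.
lra.
Unshelve. all: by end_near. Qed.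

(** Along the ray through [y] the gradient is [g'(t)] times a fixed unit vector,
    and a coordinate where this vector does not vanish recovers [g']. *)
Lemma derivable_derive1_radial (y : 'rV[R]_n) : y != 0 ->
  differentiable (grad (g \o enorm)) y -> derivable (derive1 g) (enorm y) 1.
Proof.
move=> y0 dG; have t0 : 0 < enorm y by rewrite enorm_gt0.
set t := enorm y in t0 *.
have [i yi] : exists i, y 0 i != 0.
  apply/existsP; apply: contraNT y0; rewrite negb_exists => /forallP y0.
  by apply/eqP/rowP => i; rewrite mxE; apply/eqP; rewrite -[_ == _]negbK.
have /cvg_ex[l Gl] := @diff_derivable _ _ _ _ y (t^-1 *: y) dG.
have Gli := continuous_cvg _ (@coord_continuous R 1 n 0 i l) Gl.
apply/cvg_ex; exists (t / y 0 i * l 0 i).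
have hc := cvgM (cvg_cst (t / y 0 i)) (Gli _).
apply: (cvg_trans _ (hc _ _ _)); apply: near_eq_cvg.
have : \forall h \near 0^', `|h : R| < t by apply: dnbhs0_lt.
apply: filterS => h ht /=.
have -> : h *: (t^-1 *: y) + y = (1 + h / t) *: y.
  by rewrite scalerA scalerDl scale1r addrC.
have h1 : 0 < 1 + h / t.
  rewrite -(pmulr_lgt0 _ t0) mulrDl mul1r divfK ?gt_eqF//.
  by move: ht; rewrite ltr_norml => /andP[]; lra.
rewrite !grad_radial enormZ gtr0_norm// -/t !mxE /=.
have -> : (1 + h / t) * t = h *: 1 + t.
  by rewrite mulrDl mul1r divfK ?gt_eqF// addrC -[h *: 1]/(h * 1) mulr1.
set d1 := derive1 g _; set d0 := derive1 g t.
rewrite -[h^-1 *: (d1 - d0)]/(h^-1 * (d1 - d0)).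
have ht1 : h *: 1 + t != 0.
  have -> : h *: 1 + t = (1 + h / t) * t.
    by rewrite mulrDl mul1r divfK ?gt_eqF// addrC -[h *: 1]/(h * 1) mulr1.
  by rewrite mulf_neq0 ?gt_eqF.
move: ht1; rewrite -[h *: 1]/(h * 1) mulr1 => ht1.
move: (h^-1) => ih; field.
by rewrite yi ht1 gt_eqF.
Qed.

(** The exact Hessian has the eigenvalue [g''(t)] along [y] and [g'(t) / t] on the
    orthogonal complement; the bound is their combination up to the factor [2]. *)
Lemma hess_radial_bound (y v : 'rV[R]_n) : y != 0 ->
  enorm (v *m hess (g \o enorm) y) <=
  (`|derive1n 2 g (enorm y)| + 2 * `|derive1 g (enorm y)| / enorm y) * enorm v.
Proof.
move=> y0; have t0 : 0 < enorm y by rewrite enorm_gt0.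
rewrite /hess; have [dG|/jacobian_not_differentiable ->] :=
  pselect (differentiable (grad (g \o enorm)) y); last first.
  by rewrite mulmx0 enorm0 mulr_ge0 ?addr_ge0 ?divr_ge0 ?mulr_ge0 ?enorm_ge0.
apply: jacobian_bound => // e e0.
have zy s : enorm (y + s *: v - y) = `|s| * enorm v.
  by rewrite addrAC subrr add0r enormZ.
have [v0|v0] := eqVneq v 0.
  near=> s; rewrite v0 scaler0 addr0 subrr enorm0 mulr0 add0r.
  by rewrite mulr_ge0// ltW.
have vp : 0 < enorm v by rewrite enorm_gt0.
set c2 := derive1n 2 g (enorm y).
have cvg2 := derivable_derive1_radial y0 dG.
pose e1 := e / enorm v; have e10 : 0 < e1 by rewrite divr_gt0.
have [d d0 hd] : exists2 d : R, 0 < d & forall h, `|h| < d ->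
    `|derive1 g (h + enorm y) - derive1 g (enorm y)| <=
    `|h| * (`|c2| + e1).
  have := @cvg2; rewrite /derivable => /cvgrPdist_le/(_ e1 e10).
  rewrite near_withinE => /nbhs_ballP[d /= d0 hd]; exists d => // h hd'.
  have [->|h0] := eqVneq h 0; first by rewrite add0r subrr !normr0 mul0r.
  have hp : 0 < `|h| by rewrite normr_gt0.
  have c2E : c2 = 'D_1 (derive1 g) (enorm y) by rewrite /c2 /derive1n/= derive1E.
  pose A := derive1 g (h + enorm y) - derive1 g (enorm y).
  have hB : `|c2 - h^-1 * A| <= e1.
    rewrite c2E /A -[h in derive1 g (h + _)]mulr1; apply: (hd h) => //.
    by rewrite /ball/= sub0r normrN.
  rewrite -ler_pdivrMl// -normfV -normrM -/A.
  have -> : h^-1 * A = c2 - (c2 - h^-1 * A) by rewrite opprB addrC subrK.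
  by apply: le_trans (ler_normB _ _) _; rewrite lerD2l.
have : \forall s \near (0 : R), `|s| < d / enorm v.
  by apply: nbhs0_lt; rewrite divr_gt0.
apply: filterS => s; rewrite ltr_pdivlMr// => sd.
apply: le_trans (grad_radial_dist _ y0) _.
have := ler_dist_enorm (y + s *: v) y; rewrite zy => hdist.
have := hd (enorm (y + s *: v) - enorm y) (le_lt_trans hdist sd).
rewrite subrK => h1.
set c := `|c2| in h1 *.
have h2 : `|enorm (y + s *: v) - enorm y| * (c + e1) <= `|s| * enorm v * (c + e1).
  have c_ge0 : 0 <= c := normr_ge0 _.
  by rewrite ler_wpM2r// addr_ge0// ltW.
have eE : e = e1 * enorm v by rewrite divfK ?gt_eqF.
rewrite eE; set k := _ / _ in h1 h2 *; lra.
Unshelve. all: by end_near. Qed.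

End radial_gradient.

(** * Conjugate of an isotropic function *)

Section isotropic_conjugate.
Variables (R : realType) (n : nat) (phi : 'rV[R]_n -> \bar R) (h : R -> \bar R).
Hypothesis n_gt0 : (0 < n)%N.
Hypothesis phi_h : forall x, phi x = h (enorm x).
Hypothesis h_ge0 : forall t, (0 <= h t)%E.
Hypothesis h0 : h 0 = 0%E.

(* The values of [h] at negative reals are not determined by [phi]; those of
   [psi] are. *)
Let psi (s : R) := h `|s|.

Lemma exists_unit_direction (y : 'rV[R]_n) :
  exists2 e : 'rV[R]_n, enorm e = 1 & y = enorm y *: e.
Proof.
have [->|y0] := eqVneq y 0.
  exists (delta_mx 0 (Ordinal n_gt0)); first exact: enorm_delta.
  by rewrite enorm0 scale0r.
exists ((enorm y)^-1 *: y).
  by rewrite enormZ normfV ger0_norm ?enorm_ge0// mulVf// gt_eqF// enorm_gt0.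
by rewrite scalerA divff ?scale1r// gt_eqF// enorm_gt0.
Qed.

(** Cauchy-Schwarz gives one inequality, and points on the line spanned by [y]
    the other. *)
Lemma conjugate_radial (y : 'rV[R]_n) :
  conjugate phi y = conjugate1 psi (enorm y).
Proof.
have [e e1 ye] := exists_unit_direction y.
apply/eqP; rewrite eq_le; apply/andP; split; apply: ge_ereal_sup => _ [x _ <-].
  apply: (@le_trans _ _ ((enorm x * enorm y)%:E - psi (enorm x))%E).
    rewrite /psi ger0_norm ?enorm_ge0// phi_h leeD2r//.
    by rewrite lee_fin cauchy_schwarz.
  by apply: ereal_sup_ubound; exists (enorm x).
apply: ereal_sup_ubound; exists (x *: e) => //.
rewrite phi_h enormZ e1 mulr1 {1}ye dotpZl dotpZr.
by rewrite -sqr_enorm e1 expr1n mulr1.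
Qed.

(** For [t >= 0] the supremum defining either conjugate is reached by
    nonnegative arguments, where the two functions agree. *)
Lemma conjugate1_even_ext (t : R) : 0 <= t ->
  conjugate1 psi t = conjugate1 h t.
Proof.
move=> t0; apply/eqP; rewrite eq_le; apply/andP; split;
    apply: ge_ereal_sup => _ [x _ <-].
  apply: (@le_trans _ _ ((`|x| * t)%:E - h `|x|)%E).
    by rewrite leeD2r// lee_fin ler_wpM2r// ler_norm.
  by apply: ereal_sup_ubound; exists `|x|.
have [x0|x0] := leP 0 x.
  by apply: ereal_sup_ubound; exists x => //; rewrite /psi ger0_norm.
apply: (@le_trans _ _ 0%E).
  rewrite -(adde0 0%E); apply: leeD.
    by rewrite lee_fin mulr_le0_ge0// ltW.
  by rewrite leeNl oppe0.
apply: ereal_sup_ubound; exists 0 => //.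
by rewrite /psi normr0 h0 mul0r oppe0 adde0.
Qed.

Let D := [set s : R | (psi s < +oo)%E].
Let F (s : R) := fine (psi s).

Let psiE s : D s -> psi s = (F s)%:E.
Proof.
by move=> Ds; rewrite /F fineK// ge0_fin_numE; [exact: Ds | exact: h_ge0].
Qed.

Let F_convex (mu : R) :
  (forall (x y : 'rV[R]_n) (t : R), 0 < t < 1 ->
      (phi (t *: x + (1 - t) *: y)%R <=
       t%:E * phi x + (1 - t)%:E * phi y
       - (mu / 2 * (t * (1 - t)) * enorm (x - y)%R ^+ 2)%:E)%E) ->
  forall x y t : R, D x -> D y -> 0 < t < 1 ->
  D (t * x + (1 - t) * y) /\ F (t * x + (1 - t) * y) <=
    t * F x + (1 - t) * F y - mu / 2 * (t * (1 - t)) * (x - y) ^+ 2.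
Proof.
move=> sc x y t Dx Dy t01; pose e : 'rV[R]_n := delta_mx 0 (Ordinal n_gt0).
have phie s : phi (s *: e) = psi s by rewrite phi_h enormZ enorm_delta mulr1.
have := sc (x *: e) (y *: e) t t01.
rewrite !scalerA -scalerDl -scalerBl enormZ enorm_delta mulr1.
rewrite real_normK ?num_real//.
rewrite !phie (psiE Dx) (psiE Dy) => le.
have Dz : D (t * x + (1 - t) * y) by apply: le_lt_trans le _; rewrite ltry.
by split => //; move: le; rewrite (psiE Dz) lee_fin.
Qed.

(** Strong convexity between [0] and [s], with [h] nonnegative, yields
    [F s >= mu / 4 * s ^+ 2]. Hence the conjugate of [psi] is finite, and the
    one-variable theory of conjugates applies to it. *)
Lemma isotropic_conjugate : strongly_convex phi ->
  exists g : R -> R, exists2 K : R, 0 <= K &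
  [/\ quadratic_sandwich K g,
      fine \o conjugate phi = g \o enorm,
      forall t, 0 <= t -> g t = fine (conjugate1 h t),
      g 0 = 0 & forall t, 0 <= g t].
Proof.
move=> [mu mu0 sc]; have Fc := F_convex sc.
have D0 : D 0 by rewrite /D/= /psi normr0 h0.
have F00 : F 0 = 0 by rewrite /F /psi normr0 h0.
have F_ge0 s : 0 <= F s by rewrite fine_ge0// /psi.
have F_growth s : D s -> mu / 4 * s ^+ 2 <= F s.
  move=> Ds; have t01 : 0 < (2^-1 : R) < 1 by lra.
  have [_] := Fc s 0 2^-1 Ds D0 t01.
  have := F_ge0 (2^-1 * s + (1 - 2^-1) * 0); rewrite F00 subr0; lra.
pose g t := fine (conjugate1 psi t).
have conj_le t : (conjugate1 psi t <= (mu^-1 * t ^+ 2)%:E)%E.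
  apply: ge_ereal_sup => _ [s _ <-].
  have [Ds|] := pselect (D s); last first.
    rewrite /D/= => /negP; rewrite -leNgt leye_eq => /eqP ->.
    by rewrite addeNy leNye.
  rewrite (psiE Ds) lee_fin; have := F_growth s Ds.
  have tE : t = mu * (mu^-1 * t) by field; rewrite gt_eqF.
  have -> : mu^-1 * t ^+ 2 = mu * (mu^-1 * t) ^+ 2 by field; rewrite gt_eqF.
  move: (mu^-1 * t) tE => w ->.
  have : 0 <= mu * (s - 2 * w) ^+ 2 by rewrite mulr_ge0 ?sqr_ge0 ?ltW.
  lra.
have conj_ge0 t : (0 <= conjugate1 psi t)%E.
  apply: ereal_sup_ubound; exists 0 => //.
  by rewrite /psi normr0 h0 mul0r oppe0 adde0.
have gE t : conjugate1 psi t = (g t)%:E.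
  rewrite fineK// ge0_fin_numE//; exact: le_lt_trans (conj_le t) (ltry _).
have g_ub t x : D x -> x * t - F x <= g t.
  move=> Dx; rewrite -lee_fin -gE EFinB -psiE//.
  by apply: ereal_sup_ubound; exists x.
have g_approx t e : 0 < e -> exists2 x, D x & g t - e < x * t - F x.
  move=> e0; have : ((g t - e)%:E < conjugate1 psi t)%E.
    by rewrite gE lte_fin ltrBlDr ltrDl.
  move=> /ereal_sup_gt[_ [x _ <-] lt]; exists x.
    rewrite /D/= ltNge leye_eq; apply/negP => /eqP px.
    by move: lt; rewrite px addeNy.
  move: lt; have [Dx|] := pselect (D x); first by rewrite (psiE Dx) lte_fin.
  rewrite /D/= => /negP; rewrite -leNgt leye_eq => /eqP ->.
  by rewrite addeNy.
exists g; exists mu^-1; first by rewrite invr_ge0 ltW.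
split.
- exact: (conjugate_quadratic_sandwich mu0 Fc g_ub g_approx).
- by apply/funext => y /=; rewrite conjugate_radial.
- by move=> t t0; rewrite /g conjugate1_even_ext.
- apply/eqP; rewrite eq_le -lee_fin -gE; have := conj_le 0.
  rewrite expr0n mulr0 => ->/=.
  by rewrite -lee_fin -gE.
- by move=> t; rewrite -lee_fin -gE.
Qed.

End isotropic_conjugate.

(** * Growth at infinity *)

(** For [C] large the polynomial [C *: q - p] has the degree of [q] and a
    positive leading coefficient. *)
Lemma poly_dominated (R : realType) (p q : {poly R}) :
  (size p <= size q)%N -> 0 < lead_coef q ->
  exists2 C : R, 0 < C & \forall x \near +oo, p.[x] <= C * q.[x].
Proof.
move=> pq lq; pose d := (size q).-1.
have q0 : (0 < size q)%N.
  by rewrite lt0n size_poly_eq0 -lead_coef_eq0 gt_eqF.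
pose C := (`|p`_d| + 1) / lead_coef q.
have C0 : 0 < C by rewrite divr_gt0// ltr_wpDl.
exists C => //; pose w := C *: q - p.
have wd : 0 < w`_d.
  rewrite coefB coefZ -lead_coefE divfK ?gt_eqF//.
  by have := ler_norm p`_d; lra.
have sw : size w = size q.
  apply/eqP; rewrite eqn_leq; apply/andP; split.
    apply: leq_trans (size_polyD _ _) _.
    by rewrite size_polyN geq_max pq size_scale_leq.
  rewrite -(prednK q0) ltnNge; apply: contraTN wd => /leq_sizeP ->//.
  by rewrite ltxx.
have lw : 0 < lead_coef w by rewrite lead_coefE sw.
have [N wN] := poly_pinfty_gt_lc lw.
near=> x; have := wN x; rewrite !hornerE => h.
have : lead_coef w <= C * q.[x] - p.[x] by
  apply: h; near: x; exact: nbhs_pinfty_ge (num_real _).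
by move=> /(lt_le_trans lw); rewrite subr_gt0 => /ltW.
Unshelve. all: by end_near. Qed.

(** With [w = q.[r] / Lbar <= t]: since [q] has larger degree than [p], [r * p.[r]]
    is at most a multiple of [w], and [w] tends to infinity. So does [t], and
    [t * b t] is bounded; moreover [a t / t <= a w / w] and
    [p.[r] * (a w / w) = (r * p.[r] / w) * (a w / r)], whose last factor tends to
    [0] by the hypothesis on [a] for the polynomial [Lbar^-1 *: q]. *)
Lemma growth_balance (R : realType) (a b : R -> R) (p q : {poly R}) (Lbar C2 : R) :
  0 < Lbar ->
  (size p < size q)%N -> (1 < size q)%N -> 0 < lead_coef q ->
  (forall t, 0 < t -> 0 <= a t) ->
  (forall y z, 0 < y -> y <= z -> a z / z <= a y / y) ->
  y * b y @[y --> +oo] --> C2 ->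
  (forall s : {poly R}, a s.[y] / y @[y --> +oo] --> (0 : R)) ->
  exists B : R, \forall r \near +oo, forall t, q.[r] <= Lbar * t -> 0 <= p.[r] ->
    0 < t /\ p.[r] * (`|b t| + 2 * `|a t| / t) <= B.
Proof.
move=> L0 pq sq lq a_ge0 a_decr b_lim a_lim.
pose Q := Lbar^-1 *: q.
have lQ : 0 < lead_coef Q by rewrite lead_coefZ mulr_gt0// invr_gt0.
have sQ : size Q = size q by rewrite size_scale// invr_eq0 gt_eqF.
have [C C0 pC] : exists2 C, 0 < C & \forall x \near +oo, ('X * p).[x] <= C * Q.[x].
  apply: poly_dominated => //; rewrite sQ; apply: leq_trans pq.
  by apply: leq_trans (size_polyMleq _ _) _; rewrite size_polyX.
have [C' C'0 XC] : exists2 C, 0 < C & \forall x \near +oo, 'X.[x] <= C * Q.[x].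
  by apply: poly_dominated => //; rewrite sQ size_polyX.
have [T bT] : exists T, forall t, T < t -> `|t * b t| <= `|C2| + 1.
  have : \forall t \near +oo, `|t * b t| <= `|C2| + 1.
    have /cvgrPdist_le/(_ 1 ltr01) := b_lim.
    apply: filterS => t h.
    have -> : t * b t = C2 - (C2 - t * b t) by ring.
    by apply: le_trans (ler_normB _ _) _; rewrite lerD2l.
  by move=> [T [_ h]]; exists T => t tT; exact: h.
have aQ : \forall r \near +oo, a Q.[r] / r <= 1.
  have /cvgrPdist_le/(_ 1 ltr01) := a_lim Q.
  by apply: filterS => r; rewrite sub0r normrN; apply: le_trans; exact: ler_norm.
exists (C * (`|C2| + 1) + 2 * C); near=> r => t qt p0.
have r1 : 1 <= r by near: r; exact: nbhs_pinfty_ge (num_real _).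
have r0 : 0 < r by apply: lt_le_trans r1.
have rT : C' * (`|T| + 1) <= r by near: r; exact: nbhs_pinfty_ge (num_real _).
have prC : r * p.[r] <= C * Q.[r].
  have -> : r * p.[r] = ('X * p).[r] by rewrite !hornerE.
  by near: r.
have rQ : r <= C' * Q.[r].
  by rewrite -[leLHS](hornerX r); near: r.
have aQr : a Q.[r] / r <= 1 by near: r.
have QE : Q.[r] = Lbar^-1 * q.[r] by rewrite hornerZ.
set w := Q.[r] in prC rQ aQr QE.
have wT : `|T| + 1 <= w by rewrite -(ler_pM2l C'0); apply: le_trans rQ.
have w0 : 0 < w by apply: lt_le_trans wT; rewrite ltr_wpDl.
have wt : w <= t by rewrite QE ler_pdivrMl.
have t0 : 0 < t by apply: lt_le_trans wt.
have tT : T < t.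
  apply: lt_le_trans wt; apply: lt_le_trans wT.
  by apply: le_lt_trans (ler_norm T) _; rewrite ltrDl.
split => //.
have pw : p.[r] / w <= C / r.
  by rewrite ler_pdivrMr// mulrAC ler_pdivlMr// mulrC.
have Cr : C / r <= C by rewrite ler_pdivrMr// ler_peMr// ltW.
have h1 : p.[r] * `|b t| <= C * (`|C2| + 1).
  have -> : p.[r] * `|b t| = p.[r] / t * `|t * b t|.
    by rewrite normrM gtr0_norm// mulrA divfK ?gt_eqF.
  apply: ler_pM => //; [by rewrite divr_ge0// ltW | | exact: bT].
  apply: le_trans Cr; apply: le_trans pw; apply: ler_wpM2l => //.
  by rewrite lef_pV2.
have h2 : p.[r] * (a t / t) <= C.
  apply: (@le_trans _ _ (p.[r] * (a w / w))).
    by rewrite ler_wpM2l// a_decr.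
  have -> : p.[r] * (a w / w) = (p.[r] / w * r) * (a w / r).
    by field; rewrite !gt_eqF.
  rewrite -[leRHS]mulr1; apply: ler_pM => //.
  - by rewrite mulr_ge0 ?divr_ge0// ltW.
  - by rewrite divr_ge0 ?a_ge0// ltW.
  - by rewrite -ler_pdivlMr.
by rewrite (ger0_norm (a_ge0 t t0)); lra.
Unshelve. all: by end_near. Qed.

(** * Second-order characterization of anisotropic smoothness *)

Theorem theorem2p11 (R : realType) (n : nat) (f : 'rV[R]_n -> R)
    (f_C2 : C2_on [set: 'rV[R]_n] f)
    (f_growth : exists (r : nat) (p q : {poly R}),
      [/\ size p = r.+1, size q = r.+2, 0 < q`_r.+1,
          (forall x : 'rV[R]_n, fnorm (hess f x) <= p.[enorm x]) &
          (forall x : 'rV[R]_n, q.[enorm x] <= enorm (grad f x))])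
    (phi : 'rV[R]_n -> \bar R)
    (phi_ref : reference_function phi)
    (phi_S : smoothness_condition phi)
    (phi_I : isotropy_condition phi) :
  forall Lbar : R, 0 < Lbar ->
    exists2 L : R, 0 < L &
      forall x : 'rV[R]_n,
        lambda_max (hess (fine \o conjugate phi) (Lbar^-1 *: grad f x)
                    *m hess f x) <= L * Lbar.
Proof.
move=> Lbar L0; have [r [p [q [sp sq q0 fp fq]]]] := f_growth.
have [n0|n_gt0] := posnP n.
  exists 1 => // x; apply: lambda_max_le => [|v]; first by rewrite mul1r ltW.
  have -> : v = 0 by apply/rowP => i; have := ltn_ord i; rewrite {2}n0.
  by rewrite mul0mx enorm0 mulr0.
have [_ _ phi_sc _ phi0] := phi_ref.
have [h /= [h_ge0 phi_h a_decr [C2 _ b_lim] a_lim]] := phi_I.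
have h0 : h 0 = 0%E by rewrite -phi0 phi_h enorm0.
have [g [K K0 [gK conjE g_hs g0 g_ge0]]] :=
  isotropic_conjugate n_gt0 phi_h h_ge0 h0 phi_sc.
have dg0 := derive1_min K0 gK g0 g_ge0.
(* The conjugate of [h] agrees with [g] on the half-line, hence so do their
   derivatives at positive points; negative points are beyond control, and [0]
   is not interior. *)
set hs := fine \o conjugate1 h in a_decr b_lim a_lim.
have near_pos (t : R) : 0 < t -> \forall s \near t, 0 < s.
  by move=> t0; exact: lt_nbhsr.
have d1 (t : R) : 0 < t -> derive1 hs t = derive1 g t.
  move=> t0; rewrite !derive1E; apply: near_eq_derive.
  by apply: filterS (near_pos t t0) => s s0; rewrite g_hs// ltW.
have d2 (t : R) : 0 < t -> derive1n 2 hs t = derive1n 2 g t.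
  move=> t0; rewrite /derive1n/= !(derive1E (derive1 _)); apply: near_eq_derive.
  by apply: filterS (near_pos t t0) => s s0; rewrite d1.
have a_ge0 (t : R) : 0 < t -> 0 <= derive1 hs t.
  by move=> t0; rewrite d1// -dg0; apply: (derive1_homo gK); exact: ltW.
have [B hB] : exists B : R, \forall r \near +oo, forall t,
    q.[r] <= Lbar * t -> 0 <= p.[r] ->
    0 < t /\ p.[r] * (`|derive1n 2 hs t| + 2 * `|derive1 hs t| / t) <= B.
  apply: (growth_balance L0 _ _ _ a_ge0 a_decr b_lim a_lim).
  - by rewrite sq sp.
  - by rewrite sq.
  by rewrite lead_coefE sq.
have [rho [_ hrho]] := hB.
have [P pP] := poly_disk_bound p `|rho|.
rewrite conjE.
(* The first term bounds the eigenvalues for [enorm x <= rho], the third one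
   beyond; the others keep [L * Lbar] positive and above both. *)
pose L := (P * (6 * K) + `|P * (6 * K)| + `|B| + 1) / Lbar.
have LE : L * Lbar = P * (6 * K) + `|P * (6 * K)| + `|B| + 1.
  by rewrite divfK// gt_eqF.
have L_gt0 : 0 < L * Lbar.
  by have := ler_norm (- (P * (6 * K))); rewrite normrN LE; have := normr_ge0 B; lra.
exists L; first by move: L_gt0; rewrite pmulr_lgt0.
move=> x; apply: lambda_max_le => [|v]; first exact: ltW.
rewrite mulmxA; apply: le_trans (enorm_mulmx _ _) _.
have p_ge0 : 0 <= p.[enorm x] by apply: le_trans (fp x); exact: sqrtr_ge0.
apply: (le_trans (ler_wpM2r (enorm_ge0 _) (fp x))).
have [xr|xr] := leP (enorm x) rho.
  apply: (@le_trans _ _ (P * (6 * K) * enorm v)).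
    rewrite -mulrA; apply: ler_pM => //; first exact: enorm_ge0.
      apply: le_trans (ler_norm _) _; apply: pP.
      by rewrite ger0_norm ?enorm_ge0// (le_trans xr)// ler_norm.
    exact: (hess_radial_lipschitz K0 gK dg0).
  rewrite ler_wpM2r ?enorm_ge0// LE.
  by have := normr_ge0 B; have := normr_ge0 (P * (6 * K)); lra.
set y := Lbar^-1 *: grad f x.
have yE : Lbar * enorm y = enorm (grad f x).
  by rewrite enormZ gtr0_norm ?invr_gt0// mulVKf// gt_eqF.
have := hrho _ xr (enorm y); rewrite yE => /(_ (fq x) p_ge0)[t0 le].
have y0 : y != 0 by rewrite -enorm_gt0.
apply: (@le_trans _ _ (B * enorm v)); last first.
  rewrite ler_wpM2r ?enorm_ge0// LE.
  have := ler_norm B; have := ler_norm (- (P * (6 * K))); rewrite normrN; lra.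
apply: le_trans (ler_wpM2l p_ge0 (hess_radial_bound K0 gK dg0 v y0)) _.
rewrite mulrA; apply: ler_wpM2r; first exact: enorm_ge0.
by move: le; rewrite (d1 _ t0) (d2 _ t0).
Qed.
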